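(* Let $n\ge 3$ and let $g$ be a connected social network on $n$ individuals for which friend-based ranking generates a complete ranking, i.e. for every pair of distinct individuals $i,j$ there exists an individual $k$ with $g_{ik}g_{jk}=1$. Then $g$ contains at least $\frac{3n}{2}-1$ links if $n$ is even and at least $\frac{3(n-1)}{2}$ links if $n$ is odd. If $n$ is odd, the unique (up to isomorphism) sparsest such network, i.e. the unique such network with the minimum number $\frac{3(n-1)}{2}$ of links, is the friendship network. If $n$ is even, the unique (up to isomorphism) sparsest such network, i.e. the unique such network with the minimum number $\frac{3n}{2}-1$ of links, is the modified windmill network in which one of the sails contains three nodes $i,j,k$ such that $i$, $j$ and $k$ are connected to the hub, $i$ is connected to $j$, and $j$ is connected to $k$.
   Context: A social network $g$ is an undirected simple graph on a finite set of $n$ individuals (nodes); $g_{ij}=1$ if $i$ and $j$ are linked and $g_{ij}=0$ otherwise ($g_{ii}=0$). Friendship network (windmill), $n$ odd: one node (the hub) is linked to all other $n-1$ nodes, and the other $n-1$ nodes are partitioned into $\frac{n-1}{2}$ pairs (the sails), the two nodes of each pair being linked to each other; there are no other links. Modified windmill network, $n$ even: one node (the hub) is linked to all other $n-1$ nodes; the other $n-1$ nodes are partitioned into one sail $\{i,j,k\}$ of three nodes and $\frac{n}{2}-2$ sails of two nodes; the two nodes of each two-node sail are linked to each other, and in the three-node sail $i$ is linked to $j$ and $j$ is linked to $k$ (and $i$ is not linked to $k$); there are no other links. *)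

(* Defs.v *)
From mathcomp Require Import all_boot.

Set Implicit Arguments.
Unset Strict Implicit.
Unset Printing Implicit Defensive.

Record social_network (I : finType) := SocialNetwork {
  link :> rel I;
  link_sym : symmetric link;
  link_irr : irreflexive link }.

Section SocialNetworks.
Variable I : finType.
Implicit Types g : social_network I.

Definition connected g : Prop := forall i j : I, connect g i j.

(* Friend-based ranking: i and j are directly compared iff some k is a friend
   of both. *)
Definition complete_ranking g : Prop :=
  forall i j : I, i != j -> exists k : I, g i k && g j k.

(* Links are unordered, hence counted as two-element sets of individuals. *)
Definition num_links g : nat := #|[set [set p.1; p.2] | p : I * I & g p.1 p.2]|.

Definition sparsest g : Prop :=
  [/\ connected g, complete_ranking g &
      forall g' : social_network I,
        connected g' -> complete_ranking g' -> num_links g <= num_links g'].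

(* P is the set of sails: for x != y, membership [set x; y] \in P says that
   x and y form a sail. *)
Definition friendship_network g : Prop :=
  exists (hub : I) (P : {set {set I}}),
    [/\ partition P [set~ hub],
        #|P| = (#|I| - 1) %/ 2,
        forall S, S \in P -> #|S| = 2 &
        forall x y, g x y =
          (x != y) && [|| x == hub, y == hub | [set x; y] \in P]].

Definition modified_windmill g : Prop :=
  exists (hub : I) (P : {set {set I}}) (i j k : I),
    [/\ partition P [set~ hub],
        [set i; j; k] \in P /\ #|[set i; j; k]| = 3,
        #|P :\ [set i; j; k]| = #|I| %/ 2 - 2,
        forall S, S \in P :\ [set i; j; k] -> #|S| = 2 &
        forall x y, g x y =
          (x != y) && [|| x == hub, y == hub,
                          [set x; y] \in P :\ [set i; j; k],
                          [set x; y] == [set i; j] |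
                          [set x; y] == [set j; k]]].

End SocialNetworks.

Definition isomorphic (I J : finType)
    (g : social_network I) (g' : social_network J) : Prop :=
  exists2 f : I -> J, bijective f & forall i j, g' (f i) (f j) = g i j.

(* Main.v *)
(* Every individual has at least two friends, so a hub forces the degree sum to
   be at least (n-1) + 2(n-1); equality means that the other individuals are
   perfectly matched, and a single unit of excess produces one path on three
   vertices besides a matching.  Without a hub, the neighbours a and b of a
   vertex of degree 2 already have deg a + deg b >= n + 1, and the friends that
   a and b miss create enough further excess to make the degree sum at least
   3n - 1, which is above the minimum for both parities.  The extremal networks
   are cographs, so isomorphisms are assembled from single vertices by joins and
   disjoint unions. *)
Require Import Defs.
From mathcomp Require Import all_boot zify.

Set Implicit Arguments.
Unset Strict Implicit.
Unset Printing Implicit Defensive.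

(** * Unordered pairs, and lower bounds on sums *)

Lemma eq_set2 (T : finType) (x y a b : T) :
  ([set x; y] == [set a; b]) = (x == a) && (y == b) || (x == b) && (y == a).
Proof.
apply/eqP/idP => [E|]; last first.
  by case/orP=> /andP[/eqP-> /eqP->] //; rewrite setUC.
have: x \in [set a; b] by rewrite -E set21.
have: y \in [set a; b] by rewrite -E set22.
have: a \in [set x; y] by rewrite E set21.
have: b \in [set x; y] by rewrite E set22.
by rewrite !inE !(eq_sym a) !(eq_sym b); do 4![case: eqP => //= _].
Qed.

(** Serves all degree counts below: the degrees of a few named vertices are kept exactly, and every
    other vertex contributes the uniform bound [c]. *)
Lemma leq_sum_seq (T : finType) (F : T -> nat) c (s : seq T) :
  uniq s -> (forall u, c <= F u) ->
  \sum_(u <- s) F u + c * (#|T| - size s) <= \sum_u F u.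
Proof.
move=> Us cF; rewrite [X in _ <= X](bigID (mem s)) /= big_uniq // leq_add2l.
rewrite -(card_uniqP Us) -(cardC (mem s)) addKn mulnC -sum_nat_const.
by rewrite leq_sum.
Qed.

(** * Degrees, and the degree sum in the absence of a hub *)

Definition nbhd (I : finType) (g : social_network I) (x : I) : {set I} :=
  [set y | g x y].

Definition is_hub (I : finType) (g : social_network I) (h : I) :=
  forall x, x != h -> g h x.

Section Degrees.
Variable I : finType.
Implicit Types (g : social_network I) (x y z a b v h : I).

(** Both sides count ordered linked pairs: the fibre of [(x, y) |-> [set x; y]] over a link consists
    of exactly the two orientations of that link. *)
Lemma handshake g : \sum_x #|nbhd g x| = (num_links g).*2.
Proof.
transitivity (\sum_x \sum_(y | g x y) 1).
  by apply: eq_bigr => x _; rewrite sum1dep_card.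
rewrite pair_big_dep /=.
transitivity (\sum_(p in [set p : I * I | g p.1 p.2]) 1).
  by apply: eq_bigl => p; rewrite inE.
rewrite (partition_big_imset (fun p : I * I => [set p.1; p.2])) /=.
rewrite -muln2 -sum_nat_const; apply: eq_bigr => L0 /imsetP[[a b] /=].
rewrite inE /= => gab ->{L0}.
have nab : a != b by apply: contraTneq gab => ->; rewrite link_irr.
rewrite sum1dep_card -[RHS](_ : #|[set (a, b); (b, a)]| = 2); last first.
  by rewrite cards2 xpair_eqE (negPf nab).
apply: eq_card => -[x y]; rewrite !inE /= eq_set2 !xpair_eqE.
apply: andb_idl => /orP[]/andP[/eqP-> /eqP->] //.
by rewrite link_sym.
Qed.

Lemma link_neq g x y : g x y -> x != y.
Proof. by apply: contraTneq => ->; rewrite link_irr. Qed.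

Lemma complete_connected g : complete_ranking g -> connected g.
Proof.
move=> cg i j; have [->|/cg[k /andP[gik gjk]]] := eqVneq i j.
  exact: connect0.
apply: connect_trans (connect1 gik) (connect1 _).
by rewrite link_sym.
Qed.

Lemma size_leq_degree g x (s : seq I) :
  uniq s -> all (g x) s -> size s <= #|nbhd g x|.
Proof.
move=> /card_uniqP <- /allP gs; apply/subset_leq_card/subsetP => y /gs.
by rewrite inE.
Qed.

(** Comparing [x] with any other vertex yields a friend [k]; comparing [x] with [k] yields a friend
    [l], which differs from [k] because it is linked to [k]. *)
Lemma complete_degree_ge2 g x :
  complete_ranking g -> 2 <= #|I| -> 2 <= #|nbhd g x|.
Proof.
move=> cg I2.
have [y yx] : exists y, y != x.
  have : 0 < #|[set~ x]| by rewrite cardsC1; lia.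
  by case/card_gt0P => y; rewrite !inE; exists y.
have [k /andP[gyk gxk]] := cg _ _ yx.
have [l /andP[gxl gkl]] := cg _ _ (link_neq gxk).
apply: (@size_leq_degree g x [:: k; l]); rewrite /= ?gxk ?gxl //.
by rewrite inE (link_neq gkl).
Qed.

Lemma hub_degree g h : is_hub g h -> #|nbhd g h| = #|I|.-1.
Proof.
move=> hubh; rewrite -(cardsC1 h); apply: eq_card => x; rewrite !inE.
by apply/idP/idP => [/link_neq|/hubh //]; rewrite eq_sym.
Qed.

(** The case where the common friend [z] of [x] and [y] is linked to only one of the dominating
    vertices. Then [z] has the friends [x], [y], [a], and [y] has the friends [b], [z] and a common
    friend [w] of [b] and [y], where [w] is not [z] since [b] misses [z]. The sum is at least (n+1)
    + 3 + 3 + 2(n-4) = 3n - 1; the successor in the conclusion avoids truncated subtraction. *)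
Lemma degree_sum_one_sided g a b y z x :
    complete_ranking g -> 3 <= #|I| ->
    #|I| + 1 <= #|nbhd g a| + #|nbhd g b| -> a != b -> a != y -> x != a ->
    ~~ g b x -> g b y -> g x z -> g y z -> g a z -> ~~ g b z ->
  x != y -> 3 * #|I| <= (\sum_u #|nbhd g u|).+1.
Proof.
move=> cg I3 dab nab nay nxa nbx gby gxz gyz gaz nbz nxy.
have dz : 3 <= #|nbhd g z|.
  apply: (@size_leq_degree g z [:: x; y; a]); rewrite /= ?inE.
    by rewrite negb_or nxy nxa eq_sym nay.
  by rewrite !(link_sym g z) gxz gyz gaz.
have [w /andP[gbw gyw]] := cg _ _ (link_neq gby).
have nbz' : b != z by apply: contraNneq nbx => ->; rewrite link_sym.
have dy : 3 <= #|nbhd g y|.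
  apply: (@size_leq_degree g y [:: b; z; w]); rewrite /= ?inE.
    rewrite negb_or nbz' (link_neq gbw) /= andbT.
    by apply: contraNneq nbz => ->.
  by rewrite (link_sym g y b) gby gyz gyw.
have U : uniq [:: a; b; z; y].
  rewrite /= !inE !negb_or nab (link_neq gaz) nay nbz' (link_neq gby) /=.
  by rewrite eq_sym (link_neq gyz).
have := leq_sum_seq U (fun u => complete_degree_ge2 u cg (ltnW I3)).
(* Four distinct vertices give 4 <= n, so that the truncated [#|I| - 4] is a true difference. *)
have := max_card (mem [:: a; b; z; y]); rewrite (card_uniqP U).
rewrite !big_cons big_nil /=; move: dab dz dy; clear.
by move: (\sum_u _) #|I| #|nbhd g a| #|nbhd g b| #|nbhd g z| #|nbhd g y|; lia.
Qed.

(* A vertex of degree 2 has neighbours [a] and [b] that are linked and jointly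
   dominate, so [deg a + deg b = n + #|common neighbours|].  As neither is a
   hub, some [x] misses [b] and some [y] misses [a]; a common friend of [x] and
   [y] forces an excess over the bound [2] on the remaining degrees. *)
Lemma hubless_degree_sum g :
    complete_ranking g -> 3 <= #|I| ->
    (forall h, exists2 x, x != h & ~~ g h x) ->
  3 * #|I| <= (\sum_u #|nbhd g u|).+1.
Proof.
move=> cg I3 nohub; have d2 u := complete_degree_ge2 u cg (ltnW I3).
have [/forallP d3|] := boolP [forall v, 3 <= #|nbhd g v|].
  have := @leq_sum_seq _ _ _ [::] isT d3.
  by rewrite big_nil add0n subn0; apply: leqW.
rewrite negb_forall => /existsP[v]; rewrite -ltnNge ltnS => dv.
have /cards2P[a [b [nab Nv]]] : #|nbhd g v| == 2 by rewrite eqn_leq dv d2.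
have gvE u : g v u = (u == a) || (u == b).
  by have := in_set2 u a b; rewrite -Nv inE.
have gva : g v a by rewrite gvE eqxx.
have gvb : g v b by rewrite gvE eqxx orbT.
(* A common friend of [v] and [a] must be [a] or [b], and it cannot be [a] itself. *)
have gab : g a b.
  have [w /andP[]] := cg _ _ (link_neq gva).
  by rewrite gvE => /orP[]/eqP-> //; rewrite link_irr.
have gba : g b a by rewrite link_sym.
(* For [u] other than [v], a common friend of [u] and [v] can only be [a] or [b]. *)
have dom u : g a u || g b u.
  have [->|/cg[k]] := eqVneq u v; first by rewrite link_sym gva.
  by rewrite gvE !(link_sym g _ u) => /andP[guk /orP[]/eqP<-];
     rewrite guk ?orbT.
have [y nya nay] := nohub a; have [x nxb nbx] := nohub b.
have gby : g b y by have := dom y; rewrite (negPf nay).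
have gax : g a x by have := dom x; rewrite (negPf nbx) orbF.
have nxa : x != a by apply: contraNneq nbx => ->.
have nyb : y != b by apply: contraNneq nay => ->.
have nxy : x != y by apply: contraNneq nay => <-.
have [z /andP[gxz gyz]] := cg _ _ nxy.
have dab : #|nbhd g a| + #|nbhd g b| = #|I| + #|nbhd g a :&: nbhd g b|.
  rewrite -cardsUI -cardsT; congr (_ + _); apply: eq_card => u.
  by rewrite !inE dom.
have vC : v \in nbhd g a :&: nbhd g b.
  by rewrite !inE !(link_sym g _ v) gva gvb.
have dab1 : #|I| + 1 <= #|nbhd g a| + #|nbhd g b|.
  by rewrite dab leq_add2l; apply/card_gt0P; exists v.
(* If [z] is linked to both [a] and [b], then [v] and [z] are two common neighbours and [z] has
   degree at least 4, so the sum is at least (n+2) + 4 + 2(n-3) = 3n. The mixed cases mirror each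
   other, exchanging [a] with [b] and [x] with [y]; domination excludes the last case. *)
have [gaz|naz] := boolP (g a z); have [gbz|nbz] := boolP (g b z).
- have nvz : v != z.
    apply: contraTneq gxz => <-.
    by rewrite link_sym gvE negb_or nxa.
  have C2 : 2 <= #|nbhd g a :&: nbhd g b|.
    have <- : #|[set v; z]| = 2 by rewrite cards2 nvz.
    apply/subset_leq_card/subsetP => u.
    by rewrite !inE => /orP[]/eqP->; rewrite ?gaz ?gbz // !(link_sym g _ v) gva.
  have dz : 4 <= #|nbhd g z|.
    apply: (@size_leq_degree g z [:: x; y; a; b]); rewrite /= ?inE.
      by rewrite !negb_or nxy nxa nxb nya nyb nab.
    by rewrite !(link_sym g z) gxz gyz gaz gbz.
  have U : uniq [:: a; b; z].
    by rewrite /= !inE !negb_or nab (link_neq gaz) (link_neq gbz).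
  have := leq_sum_seq U d2.
  rewrite !big_cons big_nil /=; move: dab C2 dz I3; clear.
  move: #|nbhd g a :&: nbhd g b| (\sum_u _) #|I|.
  by move: #|nbhd g a| #|nbhd g b| #|nbhd g z|; lia.
- by apply: (@degree_sum_one_sided g a b y z x); rewrite // eq_sym.
- apply: (@degree_sum_one_sided g b a x z y); rewrite // 1?eq_sym //.
  by rewrite [X in _ <= X]addnC.
- by have := dom z; rewrite (negPf naz) (negPf nbz).
Qed.

End Degrees.

(** * Gluing of partial isomorphisms, and perfect matchings *)

Section Isomorphisms.
Variable I : finType.
Implicit Types (g : social_network I) (x y z h i j k : I) (A B C : {set I}).

(** An isomorphism between induced subgraphs, carried by a total function whose values outside [A]
    are irrelevant; two such functions can then be glued by a mere case distinction. *)
Definition iso_on (e e' : rel I) A A' : Prop :=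
  exists f : I -> I, [/\ {in A &, injective f}, f @: A = A'
                       & {in A &, forall x y, e' (f x) (f y) = e x y}].

Lemma iso_on0 (e e' : rel I) : iso_on e e' set0 set0.
Proof.
by exists id; split=> [x y||x y]; rewrite ?inE // imset0.
Qed.

Lemma iso_on1 g g' x x' : iso_on g g' [set x] [set x'].
Proof.
exists (fun=> x'); split.
- by move=> y z /set1P-> /set1P->.
- by rewrite imset_set1.
- by move=> y z /set1P-> /set1P->; rewrite !link_irr.
Qed.

(* The graphs at stake are cographs: the lemma is used with [b = false] for
   disjoint unions and with [b = true] for joins. *)
Lemma iso_on_glue g g' (b : bool) A A' B B' :
    [disjoint A & B] -> [disjoint A' & B'] ->
    (forall x y, x \in A -> y \in B -> g x y = b) ->
    (forall x y, x \in A' -> y \in B' -> g' x y = b) ->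
  iso_on g g' A A' -> iso_on g g' B B' -> iso_on g g' (A :|: B) (A' :|: B').
Proof.
move=> dAB dAB' gb gb' [f1 [f1I f1E f1g]] [f2 [f2I f2E f2g]].
pose f x := if x \in A then f1 x else f2 x.
have fA : {in A, f =1 f1} by move=> x Ax; rewrite /f Ax.
have fB : {in B, f =1 f2}.
  by move=> x Bx; rewrite /f (disjointFl dAB Bx).
have inA x : x \in A -> f x \in A'.
  by move=> Ax; rewrite fA // -f1E imset_f.
have inB x : x \in B -> f x \in B'.
  by move=> Bx; rewrite fB // -f2E imset_f.
have gb1 x y : x \in A -> y \in B -> g' (f x) (f y) = g x y.
  by move=> Ax By; rewrite gb' ?gb ?inA ?inB.
have nf x y : x \in A -> y \in B -> f x <> f y.
  by move=> /inA + /inB + E; rewrite E => /(disjointFr dAB')->.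
exists f; split.
- move=> x y /setUP[Ax|Bx] /setUP[Ay|By] E.
  + by apply: f1I; rewrite // -!fA.
  + by case: (nf x y).
  + by case: (nf y x).
  + by apply: f2I; rewrite // -!fB.
- by rewrite imsetU (eq_in_imset fA) (eq_in_imset fB) f1E f2E.
- move=> x y /setUP[Ax|Bx] /setUP[Ay|By].
  + by rewrite !fA ?f1g.
  + exact: gb1.
  + by rewrite link_sym gb1 // link_sym.
  + by rewrite !fB ?f2g.
Qed.

Lemma iso_on_setT g g' : iso_on g g' setT setT -> isomorphic g g'.
Proof.
case=> f [fI _ fg]; exists f; last by move=> i j; apply: fg; rewrite inE.
by apply: injF_bij => x y; apply: fI; rewrite inE.
Qed.

(** The subgraph induced on [A] is 1-regular, that is, a perfect matching of [A]. Links leaving [A]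
    are unconstrained, which leaves room for the hub. *)
Definition matching_on g A : Prop := {in A, forall x, #|nbhd g x :&: A| = 1}.

Lemma matching_mate g A x : matching_on g A -> x \in A ->
  exists2 y, y \in A & {in A, forall z, g x z = (z == y)}.
Proof.
move=> mA Ax; have /eqP/cards1P[y E] := mA x Ax.
have : y \in [set y] by rewrite set11.
rewrite -E => /setIP[_ Ay]; exists y => // z Az.
by have := in_set1 z y; rewrite -E !inE Az andbT.
Qed.

(** By symmetry [x] is the only friend in [A] of its mate [y], so no link joins the pair to the rest
    of [A], and deleting the pair leaves all other mates in place. *)
Lemma matching_remove g A x : matching_on g A -> x \in A ->
  exists y, let A' := A :\: [set x; y] in
    [/\ g x y, A = [set x; y] :|: A', matching_on g A'
      & forall u w, u \in [set x; y] -> w \in A' -> g u w = false].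
Proof.
move=> mA Ax; have [y Ay gx] := matching_mate mA Ax.
have gxy : g x y by rewrite gx.
have [x' _ gy'] := matching_mate mA Ay.
have gy : {in A, forall z, g y z = (z == x)}.
  by move=> z Az; rewrite gy' //; move: (gy' x Ax);
     rewrite link_sym gxy => /esym/eqP->.
have cross u w : u \in [set x; y] -> w \in A :\: [set x; y] -> g u w = false.
  rewrite !inE negb_or => /orP[]/eqP-> /andP[/andP[nx ny] Aw].
    by rewrite gx // (negPf ny).
  by rewrite gy // (negPf nx).
exists y; split=> //.
  apply/setP => z; rewrite !inE orb_andr orbN andTb.
  by apply/esym/orb_idl => /orP[]/eqP->.
move=> z zA'; have Az : z \in A by case/setDP: zA'.
rewrite -(mA z Az); apply: eq_card => w; rewrite !inE.
have [wxy|] := boolP ((w == x) || (w == y)); last by rewrite andTb.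
by rewrite link_sym (cross w z) // !inE wxy.
Qed.

(** By induction on the size: one matched pair is peeled off on each side. A pair is the join of two
    points, and it is glued to the remainder as a disjoint union. *)
Lemma matching_iso g g' A A' : #|A| = #|A'| ->
  matching_on g A -> matching_on g' A' -> iso_on g g' A A'.
Proof.
have [m] := ubnP #|A|; elim: m A A' => // m IHm A A' Am cA mA mA'.
have [A0|[x Ax]] := set_0Vmem A.
  have /eqP : #|A'| = 0 by rewrite -cA A0 cards0.
  by rewrite cards_eq0 A0 => /eqP->; apply: iso_on0.
have [x' Ax'] : exists x, x \in A'.
  by apply/card_gt0P; rewrite -cA; apply/card_gt0P; exists x.
have [y [gxy AE mB cr]] := matching_remove mA Ax.
have [y' [gxy' AE' mB' cr']] := matching_remove mA' Ax'.
have pair : iso_on g g' [set x; y] [set x'; y'].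
  apply: (@iso_on_glue g g' true); try exact: iso_on1.
  - by rewrite disjoints1 inE (link_neq gxy).
  - by rewrite disjoints1 inE (link_neq gxy').
  - by move=> _ _ /set1P-> /set1P->.
  - by move=> _ _ /set1P-> /set1P->.
have dA : [disjoint [set x; y] & A :\: [set x; y]].
  by rewrite disjoint_sym disjoints_subset subsetDr.
have dA' : [disjoint [set x'; y'] & A' :\: [set x'; y']].
  by rewrite disjoint_sym disjoints_subset subsetDr.
have cD : #|A :\: [set x; y]| = #|A| - 2.
  by rewrite {2}AE cardsU disjoint_setI0 // cards0 cards2 (link_neq gxy); lia.
have cD' : #|A' :\: [set x'; y']| = #|A'| - 2.
  by rewrite {2}AE' cardsU disjoint_setI0 // cards0 cards2 (link_neq gxy'); lia.
rewrite AE AE'; apply: (iso_on_glue dA dA' cr cr' pair).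
apply: IHm => //; last by rewrite cD cD' cA.
have : 0 < #|A| by apply/card_gt0P; exists x.
by rewrite cD; lia.
Qed.

(** The blocks are the links inside [A]. Mates exist, so the blocks cover [A]; mates are unique, so
    two blocks sharing a vertex coincide. *)
Lemma matching_partition g A : matching_on g A ->
  exists P : {set {set I}}, [/\ partition P A, forall S, S \in P -> #|S| = 2
    & {in A &, forall x y, g x y = ([set x; y] \in P)}].
Proof.
move=> mA.
pose P := [set [set p.1; p.2]
          | p : I * I & [&& p.1 \in A, p.2 \in A & g p.1 p.2]].
have memP S : S \in P ->
    exists x y, [/\ x \in A, y \in A, g x y & S = [set x; y]].
  case/imsetP=> -[x y] /=; rewrite inE /= => /and3P[Ax Ay gxy] ->.
  by exists x, y.
have PE : {in A &, forall x y, g x y = ([set x; y] \in P)}.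
  move=> x y Ax Ay; apply/idP/imsetP => [gxy|].
    by exists (x, y); rewrite // inE /= Ax Ay.
  case=> -[u v]; rewrite inE /= => /and3P[_ _ guv] /eqP.
  by rewrite eq_set2 => /orP[]/andP[/eqP-> /eqP->]; rewrite // link_sym.
have unique x y z : x \in A -> y \in A -> z \in A -> g x y -> g x z -> y = z.
  move=> /(matching_mate mA)[w _ gx] Ay Az.
  by rewrite !gx // => /eqP-> /eqP->.
have blockE S x y : S \in P -> x \in A -> y \in A -> g x y -> x \in S ->
    S = [set x; y].
  case/memP=> u [v [Au Av guv ->]] Ax Ay gxy; rewrite !inE.
  case/orP=> /eqP xE; rewrite xE in gxy *.
    by rewrite (unique u y v).
  by rewrite setUC (unique v y u) // link_sym.
exists P; split=> //; last first.
  by move=> _ /memP[x [y [_ _ gxy ->]]]; rewrite cards2 (link_neq gxy).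
apply/and3P; split.
- apply/eqP/setP => x; apply/bigcupP/idP => [[_ /memP[u [v [Au Av _ ->]]]]|Ax].
    by case/set2P=> ->.
  have [y Ay gx] := matching_mate mA Ax.
  by exists [set x; y]; rewrite ?set21 // -PE // gx.
- apply/trivIsetP => S T PS PT; apply: contraNT => /pred0Pn[x /andP[/= Sx Tx]].
  have Ax : x \in A.
    by move: (PS) Sx => /memP[u [v [Au Av _ ->]]] /set2P[]->.
  have [y Ay gx] := matching_mate mA Ax.
  have gxy : g x y by rewrite gx.
  by rewrite (blockE S x y) // (blockE T x y).
- by apply/negP => /memP[x [y [_ _ _ /setP/(_ x)]]]; rewrite !inE eqxx.
Qed.

(** The friends of [x] inside [A] are the members of its block other than [x], and a block has two
    members. *)
Lemma partition_matching g A (P : {set {set I}}) :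
    partition P A -> (forall S, S \in P -> #|S| = 2) ->
    {in A &, forall x y, g x y = ([set x; y] \in P)} ->
  matching_on g A.
Proof.
move=> partP P2 gE x Ax.
have Px : x \in cover P by rewrite (cover_partition partP).
have /eqP := P2 _ (pblock_mem Px).
rewrite (cardsD1 x) mem_pblock Px => /eqP[<-].
apply: eq_card => y; rewrite !inE.
have [Ay|nAy] := boolP (y \in A); last first.
  rewrite andbF; apply/esym/negP => /andP[_ /(subsetP (partitionS partP _))].
  by rewrite (negPf nAy) => /(_ (pblock_mem Px)).
rewrite andbT gE //; apply/idP/andP => [PS|[nyx yS]].
  have := P2 _ PS; rewrite cards2 => nxy.
  rewrite (def_pblock (partition_trivIset partP) PS (set21 x y)) set22.
  by rewrite eq_sym; case: (x != y) nxy.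
suff <- : pblock P x = [set x; y] by apply: pblock_mem.
apply/esym/eqP; rewrite eqEcard (P2 _ (pblock_mem Px)).
rewrite cards2 eq_sym nyx andbT; apply/subsetP => z.
by rewrite !inE => /orP[]/eqP->; rewrite // mem_pblock.
Qed.

Lemma pair_partition A : ~~ odd #|A| ->
  exists2 P : {set {set I}}, partition P A & forall S, S \in P -> #|S| = 2.
Proof.
have [m] := ubnP #|A|; elim: m A => // m IHm A Am oddA.
have [->|[x Ax]] := set_0Vmem A.
  by exists set0; [rewrite partition_set0 | move=> S; rewrite inE].
have [y] : exists y, y \in A :\ x.
  by apply/card_gt0P; move: oddA; rewrite (cardsD1 x) Ax; case: #|A :\ x|.
rewrite !inE => /andP[nyx Ay].
have sA : [set x; y] \subset A.
  by apply/subsetP => z; rewrite !inE => /orP[]/eqP->.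
have cS : #|[set x; y]| = 2 by rewrite cards2 eq_sym nyx.
have cD : #|A :\: [set x; y]| = #|A| - 2 by rewrite cardsDS // cS.
have A2 : 2 <= #|A| by rewrite -cS subset_leq_card.
have [||P partP P2] := IHm (A :\: [set x; y]).
- by rewrite cD; lia.
- by rewrite cD oddB // addbF.
exists ([set x; y] |: P) => [|S /setU1P[->|/P2]//].
rewrite -(setID A [set x; y]) (setIidPr sA).
apply: partitionU1; rewrite // -?card_gt0 ?cS //.
by rewrite disjoint_sym disjoints_subset subsetDr.
Qed.

End Isomorphisms.

(** * Hubs, and the local structure of the two windmills *)

Section Windmills.
Variable I : finType.
Implicit Types (g : social_network I) (x y z h i j k : I) (A B C : {set I}).

Lemma cards3 i j k : uniq [:: i; j; k] -> #|[set i; j; k]| = 3.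
Proof.
move/card_uniqP=> E; rewrite -[RHS]E; apply: eq_card => x.
by rewrite !inE -!orbA.
Qed.

Lemma cards4 h i j k : uniq [:: h; i; j; k] -> #|[set h; i; j; k]| = 4.
Proof.
move/card_uniqP=> E; rewrite -[RHS]E; apply: eq_card => x.
by rewrite !inE -!orbA.
Qed.

Lemma disjoint_triple_rest h i j k :
  [disjoint [set i; j; k] & ~: [set h; i; j; k]].
Proof.
rewrite disjoints_subset setCK; apply/subsetP => x; rewrite !inE.
by rewrite -!orbA orbC => ->; rewrite orbT.
Qed.

Lemma partition_triple h i j k (Q : {set {set I}}) : uniq [:: h; i; j; k] ->
  partition Q (~: [set h; i; j; k]) -> partition ([set i; j; k] |: Q) [set~ h].
Proof.
move=> U partQ.
have <- : [set i; j; k] :|: ~: [set h; i; j; k] = [set~ h].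
  move: U => /andP[]; rewrite !inE !negb_or => /and3P[hi hj hk] _.
  apply/setP => x; rewrite !inE.
  have [->|_] := eqVneq x h; last by do 3![case: eqP => //= _].
  by rewrite (negPf hi) (negPf hj) (negPf hk).
apply: partitionU1; rewrite ?disjoint_triple_rest //.
by apply/set0Pn; exists j; rewrite !inE eqxx orbT.
Qed.

(** A local form of the friendship network that mentions no set of sails: degree counts produce it
    directly, and isomorphisms are built from it. *)
Definition hub_matching g h : Prop := is_hub g h /\ matching_on g [set~ h].

(** The corresponding form of the modified windmill: away from the hub, the graph is the disjoint
    union of the path [i], [j], [k] and a perfect matching. *)
Definition hub_path_matching g h i j k : Prop :=
  [/\ is_hub g h, uniq [:: h; i; j; k], [/\ g i j, g j k & ~~ g i k],
      forall x y, x \in [set i; j; k] -> y \in ~: [set h; i; j; k] ->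
        g x y = false
    & matching_on g (~: [set h; i; j; k])].

(** Brings any network with a hub into the shape of the link equations that define the windmills, so
    that only pairs avoiding the hub remain to be compared. *)
Lemma hub_link g h x y : is_hub g h ->
  g x y = (x != y) && [|| x == h, y == h | g x y].
Proof.
move=> hubh; have [->|nxy] := eqVneq x y; first by rewrite link_irr.
have [xh|_] := eqVneq x h; first by rewrite xh in nxy *; rewrite hubh // eq_sym.
by have [yh|//] := eqVneq y h; rewrite yh in nxy *; rewrite link_sym hubh.
Qed.

(** The hub is a common friend of any two other vertices; the hub and [x] share any friend of [x]
    other than the hub, which exists since [x] has degree at least 2. *)
Lemma degree_hub_complete g h : 1 < #|I| -> is_hub g h ->
  (forall x, x != h -> 2 <= #|nbhd g x|) -> complete_ranking g.
Proof.
move=> I1 hubh d2.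
have common x : x != h -> exists k, g h k && g x k.
  move=> /d2 dx; have : 0 < #|nbhd g x :\ h|.
    by move: dx; rewrite (cardsD1 h); have := leq_b1 (h \in nbhd g x); lia.
  by case/card_gt0P=> k; rewrite !inE => /andP[/hubh ghk gxk];
     exists k; rewrite ghk.
move=> x y nxy; have [xh|nxh] := eqVneq x h.
  by rewrite xh in nxy *; apply: common; rewrite eq_sym.
have [->|nyh] := eqVneq y h.
  by have [k /andP[ghk gxk]] := common _ nxh; exists k; rewrite gxk.
by exists h; rewrite !(link_sym g _ h) !hubh.
Qed.

Lemma hub_nbhd g h x : is_hub g h -> x != h ->
  #|nbhd g x| = (#|nbhd g x :&: [set~ h]|).+1.
Proof.
move=> hubh nxh; rewrite (cardsD1 h) inE link_sym hubh //.
by rewrite setDE.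
Qed.

Lemma hub_matching_degree g h x : hub_matching g h -> x != h -> #|nbhd g x| = 2.
Proof.
by move=> [hubh mh] nxh; rewrite (hub_nbhd hubh) // mh // !inE.
Qed.

Lemma hub_path_matching_degree g h i j k x : hub_path_matching g h i j k ->
  x != h -> #|nbhd g x| = 2 + (x == j).
Proof.
move=> [hubh U [gij gjk ngik] cross mA] nxh; rewrite (hub_nbhd hubh) //.
have gh y : y != h -> g h y by apply: hubh.
move: U; rewrite /= !inE !negb_or.
move=> /and4P[/and3P[nhi nhj nhk] /andP[nij nik] njk _].
congr _.+1.
have [xS|xA] := boolP (x \in [set i; j; k]); last first.
  have xA' : x \in ~: [set h; i; j; k].
    by move: xA; rewrite !inE !negb_or nxh.
  have nxj : x != j by apply: contraNneq xA => ->; rewrite !inE eqxx orbT.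
  rewrite (negPf nxj) -(mA x xA'); apply: eq_card => y; rewrite !inE.
  have [gxy|//] := boolP (g x y); rewrite !negb_or -!andbA /=.
  apply/idP/idP => [nyh|/andP[]//]; rewrite nyh /=.
  have := cross y x; rewrite link_sym gxy => yS.
  have {yS} : y \notin [set i; j; k] by apply/negP => /yS /(_ xA').
  by rewrite !inE !negb_or -!andbA.
(* On the triple, friends other than the hub stay inside the triple, so what remains is to count
   neighbours in a path: one at each end, two at the centre. *)
have nbhdE : nbhd g x :&: [set~ h] =i [pred y in [set i; j; k] | g x y].
  move=> y; rewrite inE [RHS]inE /= inE [y \in [set~ h]]inE [y \in [set h]]inE.
  have [gxy|_] := boolP (g x y); rewrite ?andbF // andbT /=.
  apply/idP/idP => [nyh|]; last first.
    by rewrite !inE => /orP[/orP[]|] /eqP->; rewrite eq_sym.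
  apply: contraTT gxy => yS; rewrite cross //.
  by move: yS; rewrite !inE !negb_or nyh.
rewrite (eq_card nbhdE).
move: (xS); rewrite !inE => /orP[/orP[]|] /eqP xE; rewrite xE.
- rewrite (negPf nij) -(card1 j); apply: eq_card => y; rewrite !inE.
  apply/andP/eqP => [[/orP[/orP[]|] /eqP->]|->];
    rewrite ?link_irr ?(negPf ngik) //.
  by rewrite eqxx orbT.
- rewrite eqxx -[RHS](_ : #|[set i; k]| = 2); last by rewrite cards2 nik.
  apply: eq_card => y; rewrite !inE.
  apply/andP/orP => [[/orP[/orP[]|] /eqP->]|[]/eqP->];
    rewrite ?link_irr ?eqxx ?orbT //.
  + by left.
  + by right.
  + by rewrite link_sym.
- rewrite eq_sym (negPf njk) -(card1 j); apply: eq_card => y; rewrite !inE.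
  apply/andP/eqP => [[/orP[/orP[]|] /eqP->]|->]; rewrite ?link_irr //.
    by rewrite link_sym (negPf ngik).
  by rewrite eqxx orbT link_sym.
Qed.

(** * Degree sums in the presence of a hub *)

Lemma hub_degree_sum g h : is_hub g h ->
  \sum_x #|nbhd g x| = #|I|.-1 + \sum_(x | x != h) #|nbhd g x|.
Proof. by move=> hubh; rewrite (bigD1 h) //= hub_degree. Qed.

Lemma hub_matching_degree_sum g h : hub_matching g h ->
  \sum_x #|nbhd g x| = 3 * (#|I| - 1).
Proof.
move=> gh; rewrite (hub_degree_sum gh.1).
under eq_bigr => x nxh do rewrite (hub_matching_degree gh nxh).
by rewrite sum_nat_const cardC1; lia.
Qed.

Lemma hub_path_matching_degree_sum g h i j k : hub_path_matching g h i j k ->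
  \sum_x #|nbhd g x| = (3 * (#|I| - 1)).+1.
Proof.
move=> gh; have [hubh U _ _ _] := gh; rewrite (hub_degree_sum hubh).
have njh : j != h.
  by move: U; rewrite /= !inE !negb_or => /andP[/and3P[_]]; rewrite eq_sym.
under eq_bigr => x nxh do rewrite (hub_path_matching_degree gh nxh).
rewrite big_split /= sum_nat_const cardC1 (bigD1 j) //= eqxx big1; first by lia.
by move=> x /andP[_ /negPf->].
Qed.

(** A vertex of degree 3 besides the hub would push the sum to (n-1) + 3 + 2(n-2) = 3n - 2. Hence
    every other vertex has degree 2: the hub and exactly one mate. *)
Lemma degree_sum_hub_matching g h : 1 < #|I| ->
    complete_ranking g -> is_hub g h ->
    \sum_x #|nbhd g x| <= 3 * (#|I| - 1) ->
  hub_matching g h.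
Proof.
move=> I1 cg hubh sum_le; split=> // x; rewrite !inE => nxh; apply/eqP.
have d2 u := complete_degree_ge2 u cg I1.
have := d2 x; have := hub_nbhd hubh nxh; move=> dx; rewrite {1}dx ltnS.
rewrite eqn_leq => ->; rewrite andbT leqNgt; apply/negP => dx2.
have U : uniq [:: h; x] by rewrite /= inE eq_sym nxh.
have := leq_sum_seq U d2.
rewrite !big_cons big_nil (hub_degree hubh) dx /=.
move: sum_le dx2 I1; clear.
by move: (\sum_u _) #|I| #|nbhd g x :&: _|; lia.
Qed.

(** One unit of excess means that exactly one vertex [j] besides the hub has degree 3 and the others
    have degree 2. The two friends of [j] other than the hub are the ends of the path. *)
Lemma degree_sum_hub_path_matching g h : 1 < #|I| ->
    complete_ranking g -> is_hub g h ->
    \sum_x #|nbhd g x| = (3 * (#|I| - 1)).+1 ->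
  exists i j k, hub_path_matching g h i j k.
Proof.
move=> I1 cg hubh sumE.
have d2 u := complete_degree_ge2 u cg I1.
have [j njh dj3] : exists2 j, j != h & 3 <= #|nbhd g j|.
  have [/exists_inP//|] := boolP [exists (j | j != h), 3 <= #|nbhd g j|].
  rewrite negb_exists_in => /forall_inP d3.
  have : \sum_(x | x != h) #|nbhd g x| <= \sum_(x | x != h) 2.
    by apply: leq_sum => x /d3; rewrite -leqNgt.
  rewrite sum_nat_const cardC1; move: sumE; rewrite (hub_degree_sum hubh).
  by move: I1; clear; move: (\sum_(_ | _) _) #|I|; lia.
(* Degree 4 would give a sum of at least (n-1) + 4 + 2(n-2) = 3n - 1, one too many; a second vertex
   of degree 3 is excluded below by the same total. *)
have dj : #|nbhd g j| = 3.
  have U : uniq [:: h; j] by rewrite /= inE eq_sym njh.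
  have := leq_sum_seq U d2.
  rewrite !big_cons big_nil (hub_degree hubh) /=.
  move: sumE dj3 I1; clear.
  by move: (\sum_u _) #|I| #|nbhd g j|; lia.
have dx x : x != h -> x != j -> #|nbhd g x| = 2.
  move=> nxh nxj; apply/eqP; rewrite eqn_leq d2 andbT leqNgt; apply/negP => dx3.
  have U : uniq [:: h; j; x].
    by rewrite /= !inE !negb_or !(eq_sym _ x) nxh nxj eq_sym njh.
  have := leq_sum_seq U d2; have := max_card (mem [:: h; j; x]).
  rewrite (card_uniqP U) !big_cons big_nil (hub_degree hubh) /=.
  move: sumE dj3 dx3; clear.
  by move: (\sum_u _) #|I| #|nbhd g j| #|nbhd g x|; lia.
move: dj; rewrite (hub_nbhd hubh njh) => -[] /eqP/cards2P[i [k [nik Nj]]].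
have gjE x : x != h -> g j x = (x == i) || (x == k).
  by move=> nxh; have := in_set2 x i k; rewrite -Nj !inE nxh andbT.
have [gji nih] : g j i /\ i != h.
  by have := set21 i k; rewrite -Nj !inE => /andP.
have [gjk nkh] : g j k /\ k != h.
  by have := set22 i k; rewrite -Nj !inE => /andP.
(* A friend [l] of [j] has degree 2, used up by the hub and [j]. This separates [i] from [k] and the
   triple from all remaining vertices. *)
have leaf l : l != h -> g j l -> forall x, x != h -> g l x = (x == j).
  move=> nlh gjl x nxh.
  have := dx l nlh; rewrite eq_sym (link_neq gjl) (hub_nbhd hubh nlh).
  move=> /(_ isT)[] /eqP/cards1P[y Ny].
  have yj : j = y by apply/set1P; rewrite -Ny !inE link_sym gjl.
  by have := in_set1 x y; rewrite -Ny -yj !inE nxh andbT.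
have nij : i != j by rewrite eq_sym (link_neq gji).
have cross x y : x \in [set i; j; k] -> y \in ~: [set h; i; j; k] ->
    g x y = false.
  rewrite !inE !negb_or => + /andP[/andP[/andP[nyh nyi] nyj] nyk].
  case/orP=> [/orP[]|] /eqP->; first by rewrite leaf // (negPf nyj).
    by rewrite gjE // (negPf nyi) (negPf nyk).
  by rewrite leaf // (negPf nyj).
exists i, j, k; split=> //.
- by rewrite /= !inE !negb_or !(eq_sym h) nih njh nkh nij nik (link_neq gjk).
- by split; rewrite // ?(link_sym g i j) // leaf // eq_sym (link_neq gjk).
- move=> x xA; move: (xA); rewrite !inE !negb_or.
  move=> /andP[/andP[/andP[nxh nxi] nxj] nxk].
  have := dx x nxh nxj; rewrite (hub_nbhd hubh nxh) => -[<-].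
  apply: eq_card => y; rewrite !inE; have [gxy|//] := boolP (g x y).
  rewrite !negb_or -!andbA /=.
  apply/idP/idP => [/andP[]//|nyh]; rewrite nyh /=.
  have := cross y x; rewrite link_sym gxy => yS.
  have {yS} : y \notin [set i; j; k] by apply/negP => /yS /(_ xA).
  by rewrite !inE !negb_or -!andbA.
Qed.

(** * Uniqueness up to isomorphism *)

Lemma hub_matching_iso g g' h h' :
  hub_matching g h -> hub_matching g' h' -> isomorphic g g'.
Proof.
move=> [hubh mh] [hubh' mh']; apply: iso_on_setT.
rewrite -[X in iso_on _ _ X _](setUCr [set h]).
rewrite -[X in iso_on _ _ _ X](setUCr [set h']).
apply: (@iso_on_glue _ _ _ true).
- by rewrite disjoints_subset setCK.
- by rewrite disjoints_subset setCK.
- by move=> _ y /set1P->; rewrite !inE => /hubh.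
- by move=> _ y /set1P->; rewrite !inE => /hubh'.
- exact: iso_on1.
- by apply: matching_iso; rewrite // !cardsC1.
Qed.

(** The cograph decomposition is: [h] joined to the disjoint union of the matching and a path, the
    path being [j] joined to the two unlinked points [i] and [k]. Each level is one use of
    [iso_on_glue]. *)
Lemma hub_path_matching_iso g g' h i j k h' i' j' k' :
  hub_path_matching g h i j k -> hub_path_matching g' h' i' j' k' ->
  isomorphic g g'.
Proof.
have setTE h0 i0 j0 k0 : [set: I] =
    [set h0] :|: ([set j0] :|: ([set i0] :|: [set k0])
                   :|: ~: [set h0; i0; j0; k0]).
  by apply/setP => x; rewrite !inE; do 4![case: eqP => //= _].
have ijkE i0 j0 k0 :
    [set j0] :|: ([set i0] :|: [set k0]) = [set i0; j0; k0].
  by rewrite setUCA setUA.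
have splits g0 h0 i0 j0 k0 : hub_path_matching g0 h0 i0 j0 k0 ->
  [/\ [disjoint [set h0] & [set i0; j0; k0] :|: ~: [set h0; i0; j0; k0]],
      [disjoint [set i0; j0; k0] & ~: [set h0; i0; j0; k0]],
      [disjoint [set j0] & [set i0] :|: [set k0]],
      [disjoint [set i0] & [set k0]] & #|[set h0; i0; j0; k0]| = 4] /\
  [/\ forall x y, x \in [set h0] ->
        y \in [set i0; j0; k0] :|: ~: [set h0; i0; j0; k0] -> g0 x y = true,
      forall x y, x \in [set j0] -> y \in [set i0] :|: [set k0] -> g0 x y = true
    & forall x y, x \in [set i0] -> y \in [set k0] -> g0 x y = false].
  move=> [hub0 U0 [gij gjk ngik] _ _].
  have card4 := cards4 U0.
  move: U0; rewrite /= !inE !negb_or.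
  move=> /and4P[/and3P[nhi nhj nhk] /andP[nij nik] njk _].
  have dh : [disjoint [set h0] & [set i0; j0; k0] :|: ~: [set h0; i0; j0; k0]].
    by rewrite disjoints1 !inE !negb_or nhi nhj nhk eqxx.
  split; split=> //.
  - exact: disjoint_triple_rest.
  - by rewrite disjoints1 !inE negb_or eq_sym nij njk.
  - by rewrite disjoints1 !inE.
  - move=> x y /set1P-> yS; apply: hub0; apply: contraTneq yS => ->.
    by rewrite (disjointFr dh) // set11.
  - by move=> _ _ /set1P-> /set2P[]->; rewrite // link_sym.
  - by move=> _ _ /set1P-> /set1P->; apply: negbTE.
move=> gP gP'.
have [[d1 d2 d3 d4 c4] [e1 e3 e4]] := splits _ _ _ _ _ gP.
have [[d1' d2' d3' d4' c4'] [e1' e3' e4']] := splits _ _ _ _ _ gP'.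
have [[_ _ _ e2 mA] [_ _ _ e2' mA']] := (gP, gP').
apply: iso_on_setT; rewrite [X in iso_on _ _ X _](setTE h i j k).
rewrite [X in iso_on _ _ _ X](setTE h' i' j' k').
rewrite -!(ijkE i j k) in d1 d2 e1 e2.
rewrite -!(ijkE i' j' k') in d1' d2' e1' e2'.
apply: (iso_on_glue d1 d1' e1 e1'); first exact: iso_on1.
apply: (iso_on_glue d2 d2' e2 e2'); last first.
  by apply: matching_iso; rewrite // cardsCs [RHS]cardsCs !setCK c4 c4'.
apply: (iso_on_glue d3 d3' e3 e3'); first exact: iso_on1.
by apply: (iso_on_glue d4 d4' e4 e4'); exact: iso_on1.
Qed.

(** * Agreement of the local forms with the definitions by sails *)

Lemma friendship_networkP g :
  friendship_network g <-> exists h, hub_matching g h.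
Proof.
split=> [[h [P [partP _ P2 gE]]]|[h [hubh mh]]]; exists h.
  split=> [x nxh|]; first by rewrite gE eqxx eq_sym nxh.
  apply: (partition_matching partP P2) => x y.
  rewrite !inE gE => /negPf-> /negPf->.
  by apply: andb_idl => /P2; rewrite cards2; case: (x != y).
have [P [partP P2 PE]] := matching_partition mh; exists P; split=> //.
  by have := card_uniform_partition P2 partP; rewrite cardsC1; lia.
move=> x y; rewrite (hub_link _ _ hubh).
have [//|nxh] := eqVneq x h; have [//|nyh] := eqVneq y h.
by rewrite PE // !inE.
Qed.

(** Removing the three-node sail leaves a partition of the other vertices into pairs, which amounts
    to a matching; conversely the triple is added to the partition obtained from the matching. *)
Lemma modified_windmillP g :
  modified_windmill g <-> exists h i j k, hub_path_matching g h i j k.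
Proof.
split=> [[h [P [i [j [k [partP [SP S3] _ P2 gE]]]]]]|[h [i [j [k gP]]]]].
  exists h, i, j, k.
  have hS : h \notin [set i; j; k].
    by apply/negP => /(subsetP (partitionS partP SP)); rewrite !inE eqxx.
  have Uijk : uniq [:: i; j; k].
    by apply/card_uniqP; rewrite -[RHS]S3; apply: eq_card => x;
       rewrite !inE orbA.
  have restE : [set~ h] :\: [set i; j; k] = ~: [set h; i; j; k].
    by apply/setP => x; rewrite !inE !negb_or -!andbA;
       do 4![case: eqP => //= _].
  have partQ := partitionD1 partP SP; rewrite restE in partQ.
  have Qrest x y : [set x; y] \in P :\ [set i; j; k] ->
      x \in ~: [set h; i; j; k] /\ y \in ~: [set h; i; j; k].
    by move=> /(partitionS partQ)/subsetP sQ; rewrite !sQ ?set21 ?set22.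
  have notQ x y : x \in [set i; j; k] ->
      ([set x; y] \in P :\ [set i; j; k]) = false.
    move=> xS; apply/negP => /Qrest[+ _]; rewrite inE => /negP[].
    by move: xS; rewrite !inE -!orbA => ->; rewrite orbT.
  move: hS Uijk; rewrite /= !inE !negb_or !andbT.
  move=> /andP[/andP[nhi nhj] nhk] /andP[/andP[nij nik] njk].
  split=> [x nxh|||x y xS yA|].
  - by rewrite gE eqxx eq_sym nxh.
  - by rewrite /= !inE !negb_or nhi nhj nhk nij nik njk.
  - rewrite !gE nij njk nik !eqxx ?orbT; split=> //=.
    rewrite !negb_or eq_sym nhi eq_sym nhk notQ ?inE ?eqxx //= !eq_set2.
    by rewrite !eqxx /= !(eq_sym k) (negPf njk) (negPf nij)
               (negPf nik) /= ?andbF.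
  - apply/negbTE; rewrite gE notQ // negb_and; apply/orP; right.
    move: (yA); rewrite !inE !negb_or => /andP[/andP[/andP[nyh nyi] nyj] nyk].
    rewrite nyh !eq_set2 (negPf nyi) (negPf nyj) (negPf nyk) !andbF /= andbT.
    by move: xS; rewrite !inE => /orP[/orP[]|] /eqP->; rewrite eq_sym.
  apply: (partition_matching partQ P2) => x y xA yA.
  rewrite gE.
  move: (xA) (yA); rewrite !inE !negb_or.
  move=> /andP[/andP[/andP[nxh nxi] nxj] nxk].
  move=> /andP[/andP[/andP[nyh nyi] nyj] nyk].
  rewrite (negPf nxh) (negPf nyh) !eq_set2 (negPf nxi) (negPf nxj) (negPf nxk).
  rewrite /= !orbF; apply: andb_idl => Q.
  have := P2 [set x; y]; rewrite !inE Q => /(_ isT).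
  by rewrite cards2; case: (x != y).
have [hubh U [gij gjk ngik] cross mA] := gP.
have [Q [partQ Q2 QE]] := matching_partition mA.
have c4 := cards4 U.
have c3 : #|[set i; j; k]| = 3 by apply: cards3; case/andP: U.
have SQ : [set i; j; k] \notin Q by apply/negP => /Q2; rewrite c3.
have dS := disjoint_triple_rest h i j k.
have notQ x y : x \in [set i; j; k] -> ([set x; y] \in Q) = false.
  move=> xS; apply/negP => /(partitionS partQ)/subsetP/(_ x).
  by rewrite set21 (disjointFr dS) // => /(_ isT).
move: (U); rewrite /= !inE !negb_or.
move=> /and4P[/and3P[nhi nhj nhk] /andP[nij nik] njk _].
exists h, ([set i; j; k] |: Q), i, j, k; rewrite setU1K //.
split=> //.
- exact: partition_triple.
- by rewrite setU11.
- have := card_uniform_partition Q2 partQ.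
  by rewrite cardsCs setCK c4; move: #|I| #|Q|; clear; lia.
move=> x y; rewrite (hub_link _ _ hubh).
have [//|nxh] := eqVneq x h; have [//|nyh] := eqVneq y h.
congr (_ && _) => /=.
have rest z : z != h -> z \notin [set i; j; k] -> z \in ~: [set h; i; j; k].
  by rewrite !inE !negb_or => -> .
wlog xS : x y nxh nyh / x \in [set i; j; k] \/ y \notin [set i; j; k] => [hw|].
  have [yS|yS] := boolP (y \in [set i; j; k]); last by apply: hw => //; right.
  by rewrite link_sym setUC; apply: hw => //; left.
have nS z : z \notin [set i; j; k] ->
    [/\ z == i = false, z == j = false & z == k = false].
  by rewrite !inE !negb_or => /andP[/andP[/negPf-> /negPf->] /negPf->].
have [xS'|nxS] := boolP (x \in [set i; j; k]); last first.
  have nyS : y \notin [set i; j; k] by case: xS => // xS; rewrite xS in nxS.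
  rewrite QE ?rest // !eq_set2.
  by have [-> -> ->] := nS _ nxS; rewrite /= orbF.
rewrite notQ // !eq_set2 /=.
have [yS|nyS] := boolP (y \in [set i; j; k]); last first.
  by rewrite cross ?rest //; have [-> -> ->] := nS _ nyS; rewrite !andbF.
have [nji nki nkj] : [/\ j != i, k != i & k != j] by rewrite !(eq_sym k) eq_sym.
(* Both vertices lie on the path: nine cases, settled by the links and inequalities among [i], [j]
   and [k]. *)
move: xS' yS; rewrite !inE => /orP[/orP[]|] /eqP-> /orP[/orP[]|] /eqP->.
all: rewrite ?link_irr ?gij ?gjk ?(link_sym g j i) ?(link_sym g k j) ?gij ?gjk.
all: rewrite ?(link_sym g k i) ?(negPf ngik) ?eqxx.
all: rewrite ?(negPf nij) ?(negPf nik) ?(negPf njk).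
all: by rewrite ?(negPf nji) ?(negPf nki) ?(negPf nkj).
Qed.

(** * Existence of the windmills *)

Lemma friendship_network_exists : odd #|I| ->
  exists g : social_network I, friendship_network g.
Proof.
move=> oddI; have [h _] : exists h, h \in I.
  by apply/card_gt0P; case: #|I| oddI.
have evenC : ~~ odd #|[set~ h]| by rewrite cardsC1; lia.
have [P partP P2] := pair_partition evenC.
pose r x y := (x != y) && [|| x == h, y == h | [set x; y] \in P].
have r_sym : symmetric r.
  by move=> x y; rewrite /r eq_sym setUC; congr (_ && _); rewrite orbCA.
have r_irr : irreflexive r by move=> x; rewrite /r eqxx.
exists (SocialNetwork r_sym r_irr), h, P; split=> //.
by have := card_uniform_partition P2 partP; rewrite cardsC1; lia.
Qed.

Lemma modified_windmill_exists : 3 < #|I| -> ~~ odd #|I| ->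
  exists g : social_network I, modified_windmill g.
Proof.
move=> I4 evenI.
have [h [i [j [k U]]]] : exists h i j k : I, uniq [:: h; i; j; k].
  move: (enum_uniq I) I4; rewrite cardE.
  case: (enum I) => [|h [|i [|j [|k s]]]] //= U _.
  exists h, i, j, k; move: U; rewrite /= !inE !negb_or -!andbA.
  by do ![case/andP=> ? | move=> ?]; do ![apply/andP; split=> //].
have c4 := cards4 U.
have c3 : #|[set i; j; k]| = 3 by apply: cards3; case/andP: U.
have evenC : ~~ odd #|~: [set h; i; j; k]|.
  by rewrite cardsCs setCK c4 oddB // addbF.
have [Q partQ Q2] := pair_partition evenC.
have SQ : [set i; j; k] \notin Q by apply/negP => /Q2; rewrite c3.
pose r x y := (x != y) && [|| x == h, y == h, [set x; y] \in Q,
  [set x; y] == [set i; j] | [set x; y] == [set j; k]].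
have r_sym : symmetric r.
  by move=> x y; rewrite /r eq_sym setUC; congr (_ && _); rewrite orbCA.
have r_irr : irreflexive r by move=> x; rewrite /r eqxx.
exists (SocialNetwork r_sym r_irr), h, ([set i; j; k] |: Q), i, j, k.
rewrite setU1K //; split=> //.
- exact: partition_triple.
- by rewrite setU11.
have := card_uniform_partition Q2 partQ.
by rewrite cardsCs setCK c4; lia.
Qed.

(** * The minimum number of links and the networks attaining it *)

Lemma hub_or_degree_sum g : 3 <= #|I| -> complete_ranking g ->
  (exists h, is_hub g h) \/ 3 * #|I| <= (\sum_x #|nbhd g x|).+1.
Proof.
move=> I3 cg.
have [/existsP[h /forall_inP hubh]|] :=
    boolP [exists h, [forall (x | x != h), g h x]]; first by left; exists h.
rewrite negb_exists => /forallP nohub; right.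
apply: hubless_degree_sum => // h.
by have := nohub h; rewrite negb_forall_in => /exists_inP.
Qed.

(** A hub gives at least (n-1) + 2(n-1); without one the sum is at least 3n - 1, which is larger. *)
Lemma degree_sum_ge g : 3 <= #|I| -> complete_ranking g ->
  3 * (#|I| - 1) <= \sum_x #|nbhd g x|.
Proof.
move=> I3 cg; have d2 u := complete_degree_ge2 u cg (ltnW I3).
have [[h hubh]|] := hub_or_degree_sum I3 cg; last first.
  by move: (\sum_x _) #|I|; lia.
have := @leq_sum_seq _ _ _ [:: h] isT d2.
rewrite big_cons big_nil (hub_degree hubh) /=.
by move: (\sum_x _) #|I| I3; lia.
Qed.

(** For odd n the degree sum 3(n-1) is below 3n - 1, which forces a hub, and it leaves no excess. *)
Lemma friendship_network_links g : 3 <= #|I| -> odd #|I| ->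
  friendship_network g <->
  complete_ranking g /\ num_links g = (3 * (#|I| - 1)) %/ 2.
Proof.
move=> I3 oddI; rewrite friendship_networkP; split=> [[h gh]|[cg cl]].
  split; last first.
    have := hub_matching_degree_sum gh; rewrite handshake.
    by move: (num_links g) #|I|; lia.
  apply: (degree_hub_complete (ltnW I3) gh.1) => x nxh.
  by rewrite (hub_matching_degree gh).
have sumE : \sum_x #|nbhd g x| = 3 * (#|I| - 1).
  by rewrite handshake cl; move: #|I| oddI; lia.
have [[h hubh]|] := hub_or_degree_sum I3 cg.
  by exists h; apply: degree_sum_hub_matching; rewrite ?sumE // ltnW.
by rewrite sumE; move: #|I| I3; lia.
Qed.

(** For even n the degree sum is 3n - 2: still below 3n - 1, so there is a hub, with exactly one
    unit of excess. *)
Lemma modified_windmill_links g : 3 <= #|I| -> ~~ odd #|I| ->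
  modified_windmill g <->
  complete_ranking g /\ num_links g = (3 * #|I|) %/ 2 - 1.
Proof.
move=> I3 evenI; rewrite modified_windmillP.
split=> [[h [i [j [k gP]]]]|[cg cl]].
  have [hubh _ _ _ _] := gP; split; last first.
    have := hub_path_matching_degree_sum gP; rewrite handshake.
    by move: (num_links g) #|I| I3; lia.
  apply: (degree_hub_complete (ltnW I3) hubh) => x nxh.
  by rewrite (hub_path_matching_degree gP) // leq_addr.
have sumE : \sum_x #|nbhd g x| = (3 * (#|I| - 1)).+1.
  by rewrite handshake cl; move: #|I| evenI I3; lia.
have [[h hubh]|] := hub_or_degree_sum I3 cg.
  by exists h; apply: degree_sum_hub_path_matching; rewrite // ltnW.
by rewrite sumE; move: #|I| I3; lia.
Qed.

(** The existing member of [W] shows that the lower bound [m] is attained, so being sparsest means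
    having exactly [m] links. *)
Lemma sparsest_characterization (W : social_network I -> Prop) m :
    (exists g, W g) ->
    (forall g, W g <-> complete_ranking g /\ num_links g = m) ->
    (forall g, complete_ranking g -> m <= num_links g) ->
  (forall g, sparsest g <-> W g) /\
  (forall g, sparsest g <->
     [/\ connected g, complete_ranking g & num_links g = m]).
Proof.
move=> [g0 Wg0] WE m_min; have [cg0 lg0] := (WE g0).1 Wg0.
have sparsestE g : sparsest g <->
    [/\ connected g, complete_ranking g & num_links g = m].
  split=> [[kg cg gmin]|[kg cg gm]]; split=> //.
    apply/eqP; rewrite eqn_leq m_min // andbT -lg0.
    by apply: gmin => //; apply: complete_connected.
  by move=> g' _ cg'; rewrite gm m_min.
split=> // g; rewrite WE; split=> [/sparsestE[]//|[cg gm]].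
by apply/sparsestE; split=> //; apply: complete_connected.
Qed.

End Windmills.

Theorem theorem3 (n : nat) (I : finType) (n_ge3 : 3 <= n) (cardI : #|I| = n) :
  [/\ forall g : social_network I, connected g -> complete_ranking g ->
        (~~ odd n -> (3 * n) %/ 2 - 1 <= num_links g) /\
        (odd n -> (3 * (n - 1)) %/ 2 <= num_links g),
      odd n ->
        [/\ exists g : social_network I, friendship_network g,
            forall g : social_network I, sparsest g <-> friendship_network g,
            forall g : social_network I, sparsest g <->
              [/\ connected g, complete_ranking g &
                  num_links g = (3 * (n - 1)) %/ 2] &
            forall g g' : social_network I,
              sparsest g -> sparsest g' -> isomorphic g g']
    & ~~ odd n ->
        [/\ exists g : social_network I, modified_windmill g,
            forall g : social_network I, sparsest g <-> modified_windmill g,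
            forall g : social_network I, sparsest g <->
              [/\ connected g, complete_ranking g &
                  num_links g = (3 * n) %/ 2 - 1] &
            forall g g' : social_network I,
              sparsest g -> sparsest g' -> isomorphic g g']].

Proof.
subst n.
have odd_min (g : social_network I) : odd #|I| -> complete_ranking g ->
    (3 * (#|I| - 1)) %/ 2 <= num_links g.
  move=> oddI cg; have := degree_sum_ge n_ge3 cg; rewrite handshake.
  by move: (num_links g) #|I|; lia.
(* For even n the bound 3(n-1) is odd whereas twice the number of links is even, so the degree sum
   is at least 3n - 2. *)
have even_min (g : social_network I) : ~~ odd #|I| -> complete_ranking g ->
    (3 * #|I|) %/ 2 - 1 <= num_links g.
  move=> evenI cg; have := degree_sum_ge n_ge3 cg; rewrite handshake.
  by move: (num_links g) #|I| evenI; lia.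
split=> [g _ cg|oddI|evenI].
- by split=> ?; [apply: even_min | apply: odd_min].
- have ex := friendship_network_exists oddI.
  have [sF sL] := sparsest_characterization ex
    (fun g => friendship_network_links g n_ge3 oddI) (fun g => odd_min g oddI).
  split=> // g g' /sF/friendship_networkP[h gh] /sF/friendship_networkP[h' gh'].
  exact: hub_matching_iso gh gh'.
(* An even n that is at least 3 is at least 4, which leaves room for the hub and the three-node
   sail. *)
have I4 : 3 < #|I| by move: #|I| evenI n_ge3; lia.
have ex := modified_windmill_exists I4 evenI.
have [sF sL] := sparsest_characterization ex
  (fun g => modified_windmill_links g n_ge3 evenI) (fun g => even_min g evenI).
split=> // g g' /sF/modified_windmillP[h [i [j [k gP]]]].
move=> /sF/modified_windmillP[h' [i' [j' [k' gP']]]].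
exact: hub_path_matching_iso gP gP'.
Qed.
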